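(* Let $X$ be a separable compact Hausdorff space. If $X$ is scattered or $X$ has countable tightness, then every Tychonoff space $Y$ that is a continuous image of $X$ is S-separable.
   Context: A space $X$ is S-separable if for every sequence $(Y_n)_{n\in\mathbb{N}}$ of dense subspaces of $X$ there exists a sequence $(F_n)_{n\in\mathbb{N}}$ such that each $F_n$ is a finite subset of $Y_n$ and for each finite collection $\mathcal{F}$ of nonempty open sets of $X$ there exists $n\in\mathbb{N}$ with $U\cap F_n\neq\emptyset$ for all $U\in\mathcal{F}$. A space is scattered if every nonempty subspace of it has an isolated point (in the subspace topology). A space $X$ has countable tightness if for each $x\in X$ and each $Y\subseteq X$ with $x\in\overline{Y}$ there is a countable $E\subseteq Y$ with $x\in\overline{E}$. *)

(* Defs.v *)
From mathcomp Require Import all_boot all_order all_algebra.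
From mathcomp Require Import all_classical all_reals all_analysis.

Set Implicit Arguments.
Unset Strict Implicit.
Unset Printing Implicit Defensive.

Local Open Scope classical_set_scope.

Definition separable_space (X : topologicalType) : Prop :=
  exists D : set X, countable D /\ dense D.

Definition scattered_space (X : topologicalType) : Prop :=
  forall A : set X, A !=set0 -> isolated A !=set0.

Definition countable_tightness (X : topologicalType) : Prop :=
  forall (x : X) (Y : set X), closure Y x ->
    exists E : set X, [/\ countable E, E `<=` Y & closure E x].

(* [completely_regular_space] does not include any of the T_i axioms; see
   [uniform_separatorP] for its form with functions into [0, 1]. *)
Definition tychonoff_space (X : topologicalType) : Prop :=
  completely_regular_space X /\ hausdorff_space X.

Definition continuous_image (X Y : topologicalType) : Prop :=
  exists f : X -> Y, continuous f /\ range f = [set: Y].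

Definition S_separable (X : topologicalType) : Prop :=
  forall Y : nat -> set X, (forall n, dense (Y n)) ->
    exists F : nat -> set X,
      (forall n, finite_set (F n) /\ F n `<=` Y n) /\
      (forall W : set (set X), finite_set W ->
         (forall U, W U -> open U /\ U !=set0) ->
         exists n, forall U, W U -> U `&` F n !=set0).

(* Main.v *)
(** A countable pi-base makes a space S-separable: enumerate its finite subsets
    and let [F n] be a finite part of the [n]-th dense set that meets every
    member of the [n]-th one. So it suffices to find a countable pi-base of [Y].

    If [X] is scattered, the isolated points of [Y] are dense: for [U] open in
    [Y], take a minimal closed [B] with [U `<=` f @` B]; the image of an isolated
    point of [B] is isolated in [Y]. Every dense set contains the isolated
    points, so there are countably many of them.

    If [X] is countably tight, so is its closed image [Y], and every point [p]
    of [Y] has a countable local pi-base (Shapirovskii). Otherwise a recursion of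
    length omega_1 gives open pairs [(A_i, B_i)] with [p] in [A_i] and disjoint
    closures, such that every nonempty finite intersection of earlier members
    meets [B_i]. By compactness there are points [x_i] in the closures of all
    [A_j] with [j < i] and of all [B_j] with [j >= i]. A point in the closure of
    every tail of [x] is, by tightness, in the closure of an initial segment
    [j <= i], hence in the disjoint closures of both [A_i] and [B_i]. *)

Require Import Defs.
From mathcomp Require Import all_boot all_order all_algebra.
From mathcomp Require Import all_classical all_reals all_analysis.

Set Implicit Arguments.
Unset Strict Implicit.

Local Open Scope classical_set_scope.

(** * Countable pi-bases and S-separability *)

Lemma countable_range_eq {T : Type} {A : set T} : countable A -> A !=set0 ->
  exists e : nat -> T, range e = A.
Proof.
move=> /countable_injP[g ginj] [x0 Ax0].
(* [e n] is the element of [A] that the injection [g] sends to [n], or any element of [A] when there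
   is none. *)
have /choice[e eP] n : exists x, A x /\ ((exists2 y, A y & g y = n) -> g x = n).
  have [[y Ay gy]|nn] := pselect (exists2 y, A y & g y = n); first by exists y.
  by exists x0.
exists e; rewrite eqEsubset; split => [_ [n _ <-]|x Ax]; first by have [] := eP n.
exists (g x) => //; have [Ae ge] := eP (g x).
by apply: ginj; rewrite ?inE//; apply: ge; exists x.
Qed.

Definition pi_base (X : topologicalType) (P : set (set X)) :=
  (forall O, P O -> open O /\ O !=set0) /\
  (forall U, open U -> U !=set0 -> exists2 O, P O & O `<=` U).

Lemma pi_base_S_separable (X : topologicalType) (P : set (set X)) :
  countable P -> pi_base P -> S_separable X.
Proof.
move=> cP [PO Pbase] Y dY.
have [|E EE] := countable_range_eq (countable_finite_subset cP).
  by exists set0; split; [exact: sub0set|exact: finite_set0].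
have Efin n : E n `<=` P /\ finite_set (E n).
  by have : range E (E n) by [exists n]; rewrite EE.
have /choice[F FP] n : exists F, [/\ finite_set F, F `<=` Y n &
    forall O, E n O -> O `&` F !=set0].
  have /choice[c cE] O : exists F, [/\ finite_set F, F `<=` Y n &
      E n O -> O `&` F !=set0].
    have [EO|nEO] := pselect (E n O); last first.
      by exists set0; split => //; exact: finite_set0.
    have [Oo O0] := PO _ ((Efin n).1 _ EO).
    have [x [Ox Yx]] := dY n _ O0 Oo.
    by exists [set x]; split => [|_ ->//|_]; [exact: finite_set1|exists x].
  exists (\bigcup_(O in E n) c O); split.
  - by apply: bigcup_finite => [|O _]; [exact: (Efin n).2|case: (cE O)].
  - by move=> x [ O _ cOx]; have [_ /(_ _ cOx)] := cE O.
  - move=> O EO; have [_ _ /(_ EO) [x [Ox cOx]]] := cE O.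
    by exists x; split => //; exists O.
exists F; split=> [n|W Wfin WO]; first by have [] := FP n.
have /choice[g gP] U : exists O, W U -> P O /\ O `<=` U.
  have [WU|nWU] := pselect (W U); last by exists set0.
  by have [Uo U0] := WO _ WU; have [ O PO' OU] := Pbase _ Uo U0; exists O.
(* The chosen members of [P] inside the sets of [W] form a finite subset of [P], so it occurs as
   some [E n]. *)
have [n _ nE] : range E (g @` W).
  rewrite EE; split; last exact: finite_image.
  by move=> _ [U WU <-]; have [] := gP _ WU.
exists n => U WU; have [_ _ /(_ (g U))] := FP n.
rewrite nE => /(_ _)[|x [gx Fx]]; first by exists U.
by exists x; split => //; have [_] := gP _ WU; apply.
Qed.

(** * Compactness and images of scattered spaces *)

Lemma compact_directed (X : topologicalType) (I : Type) (D : set I)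
    (A : I -> set X) :
  compact [set: X] -> D !=set0 ->
  (forall i j, D i -> D j -> exists2 k, D k & A k `<=` A i `&` A j) ->
  (forall i, D i -> A i !=set0) ->
  exists z, forall i, D i -> closure (A i) z.
Proof.
move=> cX D0 Adir A0.
(* By directedness the sets [A i] form a base of a proper filter; [z] is one of its cluster
   points. *)
have FF : ProperFilter (filter_from D A).
  by apply: filter_from_proper => //; exact: filter_from_filter.
have [|z [_ zA]] := cX _ FF; first exact: filterT.
exists z => i Di B Bz; apply: zA => //; by exists i.
Qed.

Lemma scattered_image_isolated_dense (X Y : topologicalType) (f : X -> Y) :
  compact [set: X] -> hausdorff_space X -> scattered_space X ->
  hausdorff_space Y -> continuous f -> range f = [set: Y] ->
  forall U : set Y, open U -> U !=set0 -> exists2 y, U y & open [set y].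
Proof.
move=> cX hX sX hY fc fs U Uo [y0 Uy0].
(* Zorn's lemma is applied to the complements [C] of the closed sets [B]. *)
pose P := [set C : set X | open C /\ U `<=` f @` (~` C)].
have closedfib y : closed (f @^-1` [set y]).
  apply: preimage_closed; first by move=> x _; exact: fc.
  exact/accessible_closed_set1/hausdorff_accessible.
have [F FP Ftot|C [[Co UC] Cmax]] := @Zorn_bigcup X P.
  split; first by apply: bigcup_open => C /FP[].
  move=> y Uy; have [F0|/set0P F0] := eqVneq F set0.
    rewrite F0 bigcup_set0 setC0.
    by have : range f y by rewrite fs.
  (* The traces on the fibre of [y] of the closed sets from the chain are nonempty, closed and
     nested. A common point [z] shows that the union of the chain still satisfies the covering
     condition at [y]. *)
  have [i j Fi Fj|C FC|z zP] := @compact_directed X _ F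
      (fun C => ~` C `&` f @^-1` [set y]) cX F0.
  - have [ij|ji] := Ftot _ _ Fi Fj.
      by exists j => // x [nj fx]; split; split => // /ij.
    by exists i => // x [nj fx]; split; split => // /ji.
  - by have [_ /(_ _ Uy)[x nCx fx]] := FP _ FC; exists x.
  - have zC C : F C -> (~` C `&` f @^-1` [set y]) z.
      move=> FC; have cl : closed (~` C `&` f @^-1` [set y]).
        by apply: closedI => //; apply: open_closedC; have [] := FP _ FC.
      exact/cl/zP.
    exists z; last by have [C FC] := F0; have [] := zC _ FC.
    by move=> [C FC Cz]; have [] := zC _ FC.
have [|x [/set_mem nCx [V Vx VC]]] := sX (~` C).
  by have [x nCx _] := UC _ Uy0; exists x.
(* Passing from [C] to [C'] removes exactly the isolated point [x] from the closed set. By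
   maximality of [C], the image of what remains misses some point of [U]. *)
pose C' := C `|` V°.
have C'E : ~` C' = ~` C `&` ~` V° by rewrite setCU.
have Vx' : V° x by exact: nbhs_singleton (nbhs_interior Vx).
have [y [Uy nfy]] : exists y, U y /\ ~ (f @` (~` C')) y.
  apply: contrapT => no; apply: (Cmax C').
    by split => [|/(_ x (or_intror Vx'))//]; exact: subsetUl.
  split; first by apply: openU => //; exact: open_interior.
  by move=> y Uy; apply: contrapT => nfy; apply: no; exists y.
have only z w : U w -> ~ (f @` (~` C')) w -> (~` C) z -> f z = w -> z = x.
  move=> Uw nfw nCz fz; suff : [set x] z by [].
  rewrite -VC; split => //; apply: interior_subset.
  by apply: contrapT => nVz; apply: nfw; exists z => //; rewrite C'E.
exists y => //.
(* Every point of [U] outside the image of the complement of [C'] equals [f x], so only [y] is left.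
   That image is compact, hence closed. *)
suff -> : [set y] = U `&` ~` (f @` (~` C')).
  apply: openI => //; apply: closed_openC; apply: compact_closed => //.
  apply: continuous_compact; first exact: continuous_subspaceT.
  apply: subclosed_compact cX _ => //; apply: open_closedC.
  by apply: openU => //; exact: open_interior.
rewrite eqEsubset; split => [_ ->//|w [Uw nfw] /=].
have [z1 nC1 f1] := UC _ Uw; have [z2 nC2 f2] := UC _ Uy.
by rewrite -f1 -f2 (only z1 w) // (only z2 y).
Qed.

(** * Separability and tightness of continuous images *)

Lemma separable_image (X Y : topologicalType) (f : X -> Y) :
  continuous f -> range f = [set: Y] -> separable_space X -> separable_space Y.
Proof.
move=> fc fs [D [cD dD]]; exists (f @` D); split.
  exact: sub_countable (card_image_le _ _) cD.
move=> O [y Oy] Oo; have [x _ fx] : range f y by rewrite fs.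
have [|z [Oz Dz]] := dD (f @^-1` O) _ (open_comp (in1W fc) Oo).
  by exists x; rewrite /preimage /= fx.
by exists (f z); split => //; exists z.
Qed.

(** The image of the closure of the preimage of [B] is compact, hence closed, and contains [B]. So a
    point of the closure of [B] lifts to a point [x] of the closure of the preimage, where tightness
    of [X] applies. *)
Lemma countable_tightness_image (X Y : topologicalType) (f : X -> Y) :
  compact [set: X] -> hausdorff_space Y -> continuous f ->
  range f = [set: Y] -> countable_tightness X -> countable_tightness Y.
Proof.
move=> cX hY fc fs tX y B By.
have fcl : closed (f @` closure (f @^-1` B)).
  apply: compact_closed => //; apply: continuous_compact.
    exact: continuous_subspaceT.
  exact: subclosed_compact (@closed_closure _ _) cX _.
have [x clx fx] : (f @` closure (f @^-1` B)) y.
  apply: fcl => V /By[z [Bz Vz]]; exists z; split => //.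
  have [x _ fx] : range f z by rewrite fs.
  by exists x => //; apply: subset_closure; rewrite /preimage /= fx.
have [E [cE EB clE]] := tX _ _ clx.
exists (f @` E); split.
- exact: sub_countable (card_image_le _ _) cE.
- by move=> _ [e /EB ? <-].
- move=> V; rewrite -fx => /fc /clE[e [Ee Ve]].
  by exists (f e); split => //; exists e.
Qed.

(** * An uncountable well-order and recursion along it *)

Lemma uncountable_sets_of_nat : ~ countable [set: set nat].
Proof.
move=> /countable_injP[f finj].
(* Cantor's diagonal set for the injection [f]. *)
pose D := [set n | exists2 A, f A = n & ~ A n].
have DfD : D (f D) by apply: contrapT => nDfD; apply: (nDfD); exists D.
have [A fA nA] := DfD.
have AD : A = D by exact: (finj _ _ (in_setT _) (in_setT _) fA).
by apply: nA; rewrite AD.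
Qed.

(* The elements with a countable initial segment, for a well-order on the
   subsets of [nat], form a copy of omega_1. *)
Lemma uncountable_with_countable_segments :
  exists (I : choiceType) (lt : I -> I -> Prop),
    [/\ well_founded lt, (forall i j k, lt i j -> lt j k -> lt i k),
        (forall i j, [\/ lt i j, i = j | lt j i]),
        (forall i, countable [set j | lt j i]) & ~ countable [set: I]].
Proof.
have [R Rwo] := wochoice.well_ordering_principle (set nat).
have Rmin (A : set (set nat)) : A !=set0 ->
    exists2 z, A z & forall x, A x -> R z x.
  move=> [x Ax]; have [|z [[zA zmin] _]] := Rwo (mem A).
    by exists x; rewrite inE.
  by exists z => [|y Ay]; [rewrite inE in zA|apply: zmin; rewrite inE].
have Rtot x y : R x y \/ R y x.
  have [|z [->|->] zP] := Rmin [set x; y]; first by exists x; left.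
    by left; apply: zP; right.
  by right; apply: zP; left.
have Rrefl x : R x x by case: (Rtot x x).
have Ranti x y : R x y -> R y x -> x = y.
  move=> xy yx; have [|z [_ zuniq]] := Rwo (mem [set x; y]).
    by exists x; rewrite inE; left.
  rewrite -(zuniq x) ?(zuniq y) //; split; rewrite ?inE; try by [left|right].
    by move=> w; rewrite inE => -[->|->].
  by move=> w; rewrite inE => -[->|->].
have Rtrans x y z : R x y -> R y z -> R x z.
  move=> xy yz.
  have [|w wE wP] := Rmin [set x; y; z]; first by exists x; left; left.
  have [wx wy wz] : [/\ R w x, R w y & R w z].
    by split; apply: wP; [left; left|left; right|right].
  case: wE => [[/= wE|/= wE]|/= wE].
  - by rewrite -wE.
  - by rewrite (Ranti x y) // -wE.
  - by rewrite (Ranti y z) // -wE in xy.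
pose small := [set x | countable [set y | R y x]].
(* If [small] were countable, the least element [z] outside it would have only elements of [small]
   and itself as predecessors, so it would be small too. *)
have not_small : ~ countable small.
  move=> csmall.
  have [allsmall|/existsNP[x0 nx0]] := pselect (forall x, small x).
    apply: uncountable_sets_of_nat; apply: sub_countable csmall.
    by apply: subset_card_le => x _.
  have [|z nz zmin] := Rmin (~` small); first by exists x0.
  apply: nz; apply: (@sub_countable _ _ _ (small `|` [set z])).
    apply: subset_card_le => y /= yz.
    have [|ny] := pselect (small y); first by left.
    by right; apply: Ranti => //; exact: zmin.
  rewrite -bigcup2E; apply: bigcup_countable => // -[|[|n]] _ //=.
exists {x : set nat | `[< small x >]},
  (fun x y => R (val x) (val y) /\ val x <> val y); split.
- move=> x; apply: contrapT => nAx.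
  pose B := [set y | exists2 x, ~ Acc
    (fun x y : {x : set nat | `[< small x >]} =>
      R (val x) (val y) /\ val x <> val y) x & val x = y].
  have [|_ [z nz <-] zmin] := Rmin B; first by exists (val x), x.
  apply: nz; constructor => y [yz nyz]; apply: contrapT => ny.
  by apply: nyz; apply: Ranti => //; apply: zmin; exists y.
- move=> x y z [xy nxy] [yz nyz]; split; first exact: Rtrans yz.
  by move=> xz; apply: nxy; apply: Ranti => //; rewrite xz.
- move=> x y; have [/val_inj->|nxy] := pselect (val x = val y).
    by constructor 2.
  by have [xy|yx] := Rtot (val x) (val y); [constructor 1|constructor 3];
    split => // /esym.
- move=> x; have /countable_injP[f finj] := asboolW (valP x).
  apply/countable_injP; exists (f \o val) => y z /set_mem[yx _] /set_mem[zx _].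
  by move=> /finj fyz; apply: val_inj; apply: fyz; rewrite inE.
- move=> /countable_injP[f finj]; apply: not_small.
  apply/countable_injP.
  exists (fun x => if pselect (small x) is left sx
                   then f (exist _ x (asboolT sx)) else 0%N).
  move=> x y /set_mem sx /set_mem sy.
  case: pselect => // sx'; case: pselect => // sy' /finj.
  by rewrite !inE => /(_ Logic.I Logic.I) [].
Qed.

(** At stage [i] the earlier values form a countable subset of [Q], so a suitable next value exists.
    That they lie in [Q] is part of the induction, so the recursion is first defined with the
    default [q0]. *)
Lemma countable_segment_recursion (I : Type) (lt : I -> I -> Prop)
    (T : choiceType) (Q : set T) (G : set T -> set T) :
  well_founded lt -> (forall i, countable [set j | lt j i]) ->
  (forall S, countable S -> S `<=` Q -> exists2 q, Q q & G S q) ->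
  exists f : I -> T, forall i, Q (f i) /\ G (f @` [set j | lt j i]) (f i).
Proof.
move=> wf cseg step.
have [q0 _ _] := step _ (countable0 T) (@sub0set _ Q).
pose F i (g : forall j, lt j i -> T) := xget q0
  (Q `&` G [set q | exists j (h : lt j i), g j h = q]).
pose f := Fix wf (fun=> T) F.
have fE i : f i = xget q0 (Q `&` G (f @` [set j | lt j i])).
  rewrite /f Fix_eq => [|x g h gh]; last first.
    rewrite /F; congr (xget q0 (Q `&` G _)); rewrite eqEsubset.
    by split => q [j [ji <-]]; exists j, ji.
  rewrite {1}/F; congr (xget q0 (Q `&` G _)); rewrite eqEsubset.
  by split => q; [move=> [j [ji <-]]|move=> [j ji <-]]; exists j => //; exists ji.
exists f => i; elim/(well_founded_ind wf) : i => i IH.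
rewrite fE; apply: (@xgetPex _ q0 (Q `&` G (f @` [set j | lt j i]))).
have [||q Qq Gq] := step (f @` [set j | lt j i]).
- exact: sub_countable (card_image_le _ _) (cseg i).
- by move=> _ [j ji <-]; have [] := IH j ji.
- by exists q.
Qed.

(** * Local pi-bases *)

Definition local_pi_base (X : topologicalType) (p : X) (P : set (set X)) :=
  (forall O, P O -> open O /\ O !=set0) /\
  (forall U, nbhs p U -> exists2 O, P O & O `<=` U).

(** A nonempty open set is a neighbourhood of some point of [D], so it contains a member of the
    local pi-base there. *)
Lemma pi_base_of_dense_local (X : topologicalType) (D : set X) :
  countable D -> dense D ->
  (forall p, D p -> exists2 P, countable P & local_pi_base p P) ->
  exists2 P : set (set X), countable P & pi_base P.
Proof.
move=> cD dD locP.
have /choice[P PP] p : exists P, D p -> countable P /\ local_pi_base p P.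
  have [Dp|nDp] := pselect (D p); last by exists set0.
  by have [P cP lP] := locP _ Dp; exists P.
exists (\bigcup_(p in D) P p).
  by apply: bigcup_countable => // p Dp; have [] := PP p Dp.
split=> [ O [p Dp]|U Uo U0]; first by have [_ [+ _]] := PP p Dp; apply.
have [p [Up Dp]] := dD _ U0 Uo; have [_ [_ /(_ U)]] := PP p Dp.
by move=> [|O PO OU]; [exact: open_nbhs_nbhs|exists O => //; exists p].
Qed.

Lemma open_finite_bigcap (X : topologicalType) (F : set (set X)) :
  finite_set F -> (forall O, F O -> open O) -> open (\bigcap_(O in F) O).
Proof.
move=> /finite_seqP[s ->]; elim: s => [_|O s IH Fo].
  have -> : \bigcap_(O in [set` [::]]) O = [set: X] by rewrite eqEsubset; split.
  exact: openT.
have -> : \bigcap_(V in [set` O :: s]) V = O `&` \bigcap_(V in [set` s]) V.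
  rewrite eqEsubset; split => [x xs|x [Ox xs] V /=].
    split; first by apply: xs; rewrite /= mem_head.
    by move=> V /= Vs; apply: xs; rewrite /= inE Vs orbT.
  by rewrite inE => /predU1P[->|/xs].
apply: openI; first by apply: Fo; rewrite /= mem_head.
by apply: IH => V /= Vs; apply: Fo; rewrite /= inE Vs orbT.
Qed.

(** * Countable local pi-bases in countably tight compact spaces *)

Definition separating_pairs (X : topologicalType) (p : X) :=
  [set q : set X * set X | [/\ open q.1, q.1 p, open q.2 &
    closure q.1 `&` closure q.2 = set0]].

Definition members (X : topologicalType) (S : set (set X * set X)) :=
  [set C | exists2 q, S q & C = q.1 \/ C = q.2].

Definition unavoidable (X : topologicalType) (S : set (set X * set X)) :=
  [set q : set X * set X | forall F, F `<=` members S -> finite_set F ->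
    \bigcap_(C in F) C !=set0 -> (\bigcap_(C in F) C) `&` q.2 !=set0].

(** The nonempty finite intersections of members of [S] form a countable family of open sets. It is
    not a local pi-base at [p], so some neighbourhood [U] of [p] contains none of them. *)
Lemma exists_unavoidable (X : topologicalType) (p : X) :
  compact [set: X] -> hausdorff_space X ->
  ~ (exists2 P, countable P & local_pi_base p P) ->
  forall S, countable S -> S `<=` separating_pairs p ->
    exists2 q, separating_pairs p q & unavoidable S q.
Proof.
move=> cX hX nP S cS SQ.
have cM : countable (members S).
  have -> : members S = \bigcup_(q in S) [set q.1; q.2].
    by rewrite eqEsubset; split => [C [q Sq qC]|C [q Sq qC]]; exists q.
  by apply: bigcup_countable => // q _; exact/finite_set_countable/finite_set2.
have oM C : members S C -> open C.
  by move=> [q /SQ[op1 _ op2 _] [->|->]].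
pose M := [set \bigcap_(C in F) C | F in
  [set F | F `<=` members S /\ finite_set F]] `&` [set O | O !=set0].
have [U pU MU] : exists2 U, nbhs p U & forall O, M O -> ~ O `<=` U.
  apply: contrapT => no; apply: nP; exists M.
    apply: sub_countable (subset_card_le (@subIsetl _ _ _)) _.
    exact: sub_countable (card_image_le _ _) (countable_finite_subset cM).
  split=> [ O [[F [FM Ffin] <-] O0]|U pU].
    by split => //; apply: open_finite_bigcap => // C /FM/oM.
  apply: contrapT => nO; apply: no; exists U => // O MO OU.
  by apply: nO; exists O.
(* Regularity is used twice: the closure of [V] lies in [U], so any set not inside [U] meets the
   complement of that closure; the closure of [W] lies in the interior of [V], which separates the
   closures of the pair. *)
have reg : {for p, regular_space X} by exact: compact_regular hX cX filterT.
have [V pV VU] := reg _ pU; have [W pW WV] := reg _ (nbhs_interior pV).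
exists (W°, ~` closure V).
  split => /=.
  - exact: open_interior.
  - exact: nbhs_singleton (nbhs_interior pW).
  - exact/closed_openC/closed_closure.
  - rewrite -subset0 => x [xW]; rewrite closure_setC; apply.
    have Vsub : V° `<=` (closure V)° by apply/interiorS/subset_closure.
    exact: (Vsub _ (WV _ (closureS (@interior_subset _ W) xW))).
move=> F FM Ffin F0.
have /MU/existsNP[x] : M (\bigcap_(C in F) C) by split => //; exists F.
by move=> /not_implyP[xF nxU]; exists x; split => //= /VU.
Qed.

(* Induction on [size t]: the largest index [m] of [t] is above all the others,
   so [(f m).2] meets the intersection obtained without it. *)
Lemma free_family_meet (X : topologicalType) (p : X) (I : choiceType)
    (lt : I -> I -> Prop) (f : I -> set X * set X) :
  (forall i j k, lt i j -> lt j k -> lt i k) ->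
  (forall i j, [\/ lt i j, i = j | lt j i]) ->
  (forall i, separating_pairs p (f i) /\
     unavoidable (f @` [set j | lt j i]) (f i)) ->
  forall i (s t : seq I), (forall j, j \in s -> lt j i) ->
    (forall j, j \in t -> ~ lt j i) ->
    exists x, (forall j, j \in s -> (f j).1 x) /\
              (forall j, j \in t -> (f j).2 x).
Proof.
move=> lttr lttot fP i s t si.
have [n] := ubnP (size t); elim: n t => // n IH t tn ti.
have [->|t0] := eqVneq t [::].
  (* All first components contain [p]. *)
  by exists p; split => // j _; have [[]] := fP j.
have [m mt mmax] : exists2 m, m \in t & forall j, j \in t -> j = m \/ lt j m.
  elim: t t0 {tn ti} => // a t IHt _.
  have [->|/IHt[m mt mmax]] := eqVneq t [::].
    by exists a => [|j]; rewrite ?mem_head// inE => /eqP; left.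
  have [am|am|ma] := lttot a m.
  - by exists m => [|j]; rewrite inE ?mt ?orbT// => /predU1P[->|/mmax//]; right.
  - by exists m => [|j]; rewrite inE ?mt ?orbT// => /predU1P[->|/mmax//]; left.
  - exists a => [|j]; rewrite ?mem_head// inE => /predU1P[->|/mmax[->|jm]];
      [by left|by right|by right; exact: lttr ma].
pose t' := [seq j <- t | j != m].
have t'm j : j \in t' -> j \in t /\ lt j m.
  rewrite mem_filter => /andP[jm jt]; split => //.
  by case: (mmax _ jt) jm => // ->; rewrite eqxx.
have [||x [xs xt]] := IH t'.
- rewrite -ltnS; apply: leq_trans tn; rewrite ltnS size_filter.
  rewrite -(count_predC (pred1 m) t).
  by rewrite -add1n leq_add2r -has_count has_pred1.
- by move=> j /t'm[/ti].
have sm j : j \in s -> lt j m.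
  move=> js; have ji := si _ js; have [im|<-//|mi] := lttot i m.
    exact: lttr im.
  by have := ti _ mt.
pose F := [set (f j).1 | j in [set` s]] `|` [set (f j).2 | j in [set` t']].
have [_ /(_ F)] := fP m.
case.
- move=> C [[j js <-]|[j jt <-]]; exists (f j).
  + by exists j => //; exact: sm.
  + by left.
  + by exists j => //; have [] := t'm _ jt.
  + by right.
- by rewrite finite_setU; split; apply: finite_image; exact: finite_seq.
- by exists x => C [[j js <-]|[j jt <-]]; [exact: xs|exact: xt].
move=> y [yF ym]; exists y; split => j jin.
  by apply: yF; left; exists j.
have [->//|jm] := eqVneq j m.
by apply: yF; right; exists j => //; rewrite /= mem_filter jm.
Qed.

Lemma tight_countable_local_pi_base (X : topologicalType) (p : X) :
  compact [set: X] -> hausdorff_space X -> countable_tightness X ->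
  exists2 P, countable P & local_pi_base p P.
Proof.
move=> cX hX tX; apply: contrapT => nP.
have [I [lt [wf lttr lttot cseg ncI]]] := uncountable_with_countable_segments.
have [f fP] := countable_segment_recursion wf cseg
  (exists_unavoidable cX hX nP).
have fdisj i : closure (f i).1 `&` closure (f i).2 = set0 by have [[]] := fP i.
have /choice[x xP] i : exists x, (forall j, lt j i -> closure (f j).1 x) /\
    (forall j, ~ lt j i -> closure (f j).2 x).
  (* Finite intersections are indexed by pairs of lists; concatenating the lists shows that they are
     directed. *)
  pose D := [set st : seq I * seq I |
    (forall j, j \in st.1 -> lt j i) /\ (forall j, j \in st.2 -> ~ lt j i)].
  pose A (st : seq I * seq I) := [set x | (forall j, j \in st.1 -> (f j).1 x) /\
    (forall j, j \in st.2 -> (f j).2 x)].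
  have [|st st' [s1 t1] [s2 t2]|st [s1 t1]|z zP] := @compact_directed X _ D A cX.
  - by exists ([::], [::]).
  - exists (st.1 ++ st'.1, st.2 ++ st'.2).
      by split => j /=; rewrite mem_cat => /orP[]; auto.
    move=> y [/= ys yt]; split; split => j jin;
      by [apply: ys; rewrite mem_cat jin ?orbT|
          apply: yt; rewrite mem_cat jin ?orbT].
  - exact: free_family_meet lttr lttot fP _ _ _ s1 t1.
  exists z; split => j ji.
    have Dj : D ([:: j], [::]) by split => k //=; rewrite inE => /eqP->.
    by apply: closureS (zP _ Dj) => y [+ _]; apply; rewrite mem_head.
  have Dj : D ([::], [:: j]) by split => k //=; rewrite inE => /eqP->.
  by apply: closureS (zP _ Dj) => y [_]; apply; rewrite mem_head.
(* If no index were above all of [J], then [I] would be a countable union of countable initial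
   segments. *)
have unbounded J : countable J -> exists i, forall j, J j -> lt j i.
  move=> cJ; apply: contrapT => no; apply: ncI.
  apply: (@sub_countable _ _ _ (\bigcup_(j in J) ([set k | lt k j] `|` [set j]))).
    apply: subset_card_le => i _.
    have [j /not_implyP[Jj nji]] : exists j, ~ (J j -> lt j i).
      by apply/existsNP => h; apply: no; exists i.
    by exists j => //; have [ij|->|//] := lttot i j; [left|right].
  apply: bigcup_countable => // j _.
  by rewrite -bigcup2E; apply: bigcup_countable => // -[|[|n]] _ //=.
have tailne i : exists j, lt i j.
  by have [j jP] := unbounded [set i] (countable1 i); exists j; exact: jP.
have [i0 _] : exists i : I, True.
  by have [i _] := unbounded set0 (countable0 I); exists i.
have [|i j _ _|i _|z zP] :=
    @compact_directed X I setT (fun i => x @` [set j | lt i j]) cX.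
- by exists i0.
- have [ij|<-|ji] := lttot i j.
  + by exists j => // _ [k jk <-]; split; exists k => //; exact: lttr jk.
  + by exists i.
  + by exists i => // _ [k ik <-]; split; exists k => //; exact: lttr ik.
- by have [j ij] := tailne i; exists (x j), j.
have [|E [cE EX zE]] := tX z (range x).
  by apply: closureS (zP i0 Logic.I) => _ [j _ <-]; exists j.
have /choice[g gP] y : exists j, E y -> x j = y.
  have [/EX[j _ <-]|nE] := pselect (E y); first by exists j.
  by exists i0.
(* All points of [E] have the form [x j] with [j] below this single [i], so they lie in the closure
   of [(f i).2]; the points [x j] with [j] above [i] lie in the closure of [(f i).1]. *)
have [i iP] := unbounded (g @` E) (sub_countable (card_image_le _ _) cE).
suff : (closure (f i).1 `&` closure (f i).2) z by rewrite fdisj.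
split.
  apply: (@closed_closure _ (f i).1).
  apply: closureS (zP i Logic.I) => _ [j ij <-]; exact: (xP j).1.
apply: (@closed_closure _ (f i).2).
apply: closureS zE => y Ey; rewrite -(gP _ Ey); apply: (xP _).2.
move=> ig; have gi : lt (g y) i by apply: iP; exists y.
have ltirr j : ~ lt j j.
  by elim/(well_founded_ind wf) : j => j IH jj; exact: (IH _ jj).
exact: ltirr (lttr _ _ _ gi ig).
Qed.

(** * S-separability of continuous images *)

Unset Implicit Arguments.
Set Strict Implicit.

Theorem proposition3p14 (X : topologicalType)
  (separableX : separable_space X)
  (compactX : compact [set: X])
  (hausdorffX : hausdorff_space X)
  (hX : scattered_space X \/ countable_tightness X) :
  forall Y : topologicalType,
    tychonoff_space Y -> continuous_image X Y -> S_separable Y.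
Proof.
move=> Y [_ hY] [f [fc fs]].
have [D [cD dD]] := separable_image fc fs separableX.
suff [P cP bP] : exists2 P : set (set Y), countable P & pi_base P.
  exact: pi_base_S_separable bP.
have [sX|tX] := hX.
  exists ((fun y => [set y]) @` [set y | open [set y]]).
    apply: sub_countable (card_image_le _ _) _.
    apply: sub_countable (subset_card_le _) cD => y oy.
    by have [|_ [-> Dy]] := dD [set y] _ oy; first by exists y.
  split=> [_ [y oy <-]|U Uo U0]; first by split => //; exists y.
  have [y Uy oy] := scattered_image_isolated_dense compactX hausdorffX sX hY
    fc fs Uo U0.
  by exists [set y]; [exists y|move=> _ ->].
apply: pi_base_of_dense_local cD dD _ => p _.
have compactY : compact [set: Y].
  by rewrite -fs; apply: continuous_compact => //; exact: continuous_subspaceT.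
apply: tight_countable_local_pi_base => //.
exact: countable_tightness_image fc fs tX.
Qed.
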